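(* Let $\mathfrak{A}$ be a unital $C^*$-algebra and $a\in\mathfrak{A}$. Then the following statements are equivalent: (i) $DW_{\mathfrak{A}}(a^* )\subseteq\{(\overline{\mu},r):(\mu,r)\in DW_{\mathfrak{A}}(a)\}$. (ii) $\mathscr{L}_{\overline{\mu}}^{\mathfrak{A}}(a^* )\subseteq\mathscr{L}_{\mu}^{\mathfrak{A}}(a)$ for every $\mu\in W_{\mathfrak{A}}(a)$. As a result, $$DW_{\mathfrak{A}}(a^* )=\{(\overline{\mu},r):(\mu,r)\in DW_{\mathfrak{A}}(a)\}$$ if and only if for every $f\in\mathfrak{S}(\mathfrak{A})$ there exist $\phi,\psi\in\mathfrak{S}(\mathfrak{A})$ such that $$f(a)=\phi(a)\ \text{ with }\ \phi(a^*a)\leq f(aa^* )\qquad\text{and}\qquad f(a)=\psi(a)\ \text{ with }\ \psi(aa^* )\leq f(a^*a).$$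
   Context: $\mathfrak{A}$ is a complex, nonzero, unital $C^*$-algebra with unit $\boldsymbol{1}$; its state space $\mathfrak{S}(\mathfrak{A})$ is the set of all positive linear functionals $f\in\mathfrak{A}^*$ with $\|f\|=f(\boldsymbol{1})=1$. For any $b\in\mathfrak{A}$ (in particular $b=a$ or $b=a^*$): $W_{\mathfrak{A}}(b)=\{f(b):f\in\mathfrak{S}(\mathfrak{A})\}$; $DW_{\mathfrak{A}}(b)=\{(f(b),f(b^*b)):f\in\mathfrak{S}(\mathfrak{A})\}\subset\mathbb{C}\times\mathbb{R}$; and for $\mu\in W_{\mathfrak{A}}(b)$, $\mathscr{L}_{\mu}^{\mathfrak{A}}(b)=\{r:(\mu,r)\in DW_{\mathfrak{A}}(b)\}$. *)

(* Defs.v *)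
From HB Require Import structures.
From mathcomp Require Import all_boot all_order all_algebra.
From mathcomp Require Import complex.
From mathcomp Require Import all_classical all_reals.

Set Implicit Arguments.
Unset Strict Implicit.
Unset Printing Implicit Defensive.

Import Order.TTheory GRing.Theory Num.Theory.

Local Open Scope ring_scope.
Local Open Scope classical_set_scope.
Local Open Scope complex_scope.

(* MathComp's norm on R[i] is R[i]-valued; cabs is the modulus as a real. *)
Definition cabs (R : realType) (z : R[i]) : R := complex.Re `|z|.

(* Unital C*-algebras over C = R[i].  An algType is a unital associative
   algebra with 1 != 0.  The norm is a field of the mixin because the
   Hierarchy-Builder hierarchy admits no join of GRing.Algebra with
   NormedModule: such a join would have to be declared before numDomainType. *)
HB.mixin Record isUnitalCStar (R : realType) A of GRing.Algebra R[i] A := {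
  cnorm : A -> R ;
  adjoint : A -> A ;
  cnorm0_eq0 : forall x, cnorm x = 0 -> x = 0 ;
  cnormZ : forall (c : R[i]) x, cnorm (c *: x) = cabs c * cnorm x ;
  cnormD_le : forall x y, cnorm (x + y) <= cnorm x + cnorm y ;
  cnormM_le : forall x y, cnorm (x * y) <= cnorm x * cnorm y ;
  cnorm_complete : forall u : nat -> A,
    (forall e : R, 0 < e -> exists N, forall m n, (N <= m)%N -> (N <= n)%N ->
       cnorm (u m - u n) < e) ->
    exists l, forall e : R, 0 < e -> exists N, forall n, (N <= n)%N ->
       cnorm (u n - l) < e ;
  adjointD : forall x y, adjoint (x + y) = adjoint x + adjoint y ;
  adjointZ : forall (c : R[i]) x, adjoint (c *: x) = conjc c *: adjoint x ;
  adjointM : forall x y, adjoint (x * y) = adjoint y * adjoint x ;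
  adjointK : forall x, adjoint (adjoint x) = x ;
  cnorm_cstar : forall x, cnorm (adjoint x * x) = cnorm x ^+ 2 }.

#[short(type="unitalCStarType")]
HB.structure Definition UnitalCStar (R : realType) :=
  { A of GRing.Algebra R[i] A & isUnitalCStar R A }.

Section States.
Context {R : realType} {A : unitalCStarType R}.
Implicit Types (f : {scalar A}) (b : A).

Definition bounded_functional f : Prop :=
  exists M : R, forall x : A, cabs (f x) <= M * cnorm x.

Definition functional_norm f : R :=
  sup [set cabs (f x) | x in [set x : A | cnorm x <= 1]].

(* In the order of R[i], 0 <= z means that z is real and nonnegative. *)
Definition positive_functional f : Prop :=
  forall x : A, 0 <= f (adjoint x * x).

Definition state : set {scalar A} :=
  [set f | [/\ bounded_functional f, positive_functional f,
               functional_norm f = 1 & f 1 = 1]].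

Definition numerical_range b : set R[i] := [set f b | f in state].

(* f (b^* b) is real for every state f, so its real part loses nothing. *)
Definition DW b : set (R[i] * R) :=
  [set (f b, complex.Re (f (adjoint b * b))) | f in state].

Definition DW_section b (mu : R[i]) : set R := [set r | DW b (mu, r)].

End States.

Definition conj_fst (R : realType) (S : set (R[i] * R)) : set (R[i] * R) :=
  [set (conjc p.1, p.2) | p in S].

(* Main.v *)
Require Import Defs.
From HB Require Import structures.
From mathcomp Require Import all_boot all_order all_algebra.
From mathcomp Require Import complex.
From mathcomp Require Import all_classical all_reals.
From mathcomp Require Import ring lra.

Import Order.TTheory GRing.Theory Num.Theory.

Local Open Scope ring_scope.
Local Open Scope classical_set_scope.

(* The nontrivial direction of the second equivalence is to turn
   phi (a^* a) <= f (a a^* ) into an equality.  No hypothesis is needed for the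
   opposite bound: from f alone one gets a state chi with chi a = f a and
   f (a a^* ) <= chi (a^* a), namely f itself or a vector state
   y |-> f (x^* y x) / f (x^* x) with x = a^* + t.  A convex combination of phi
   and chi then attains the value f (a a^* ).  The other inclusion is the same
   argument for a^*. *)

(** * The real-valued modulus of complex scalars *)

Lemma normcE {R : realType} (z : R[i]) : `|z| = (cabs z)%:C%C.
Proof. by []. Qed.

Lemma cabsM {R : realType} (z w : R[i]) : cabs (z * w) = cabs z * cabs w.
Proof. by apply: (@complexI R); rewrite rmorphM /= -!normcE normrM. Qed.

Lemma cabs_ge0 {R : realType} (z : R[i]) : 0 <= cabs z.
Proof. by rewrite -lecR -normcE; exact: normr_ge0. Qed.

Lemma cabs1 {R : realType} : cabs (1 : R[i]) = 1.
Proof. by rewrite /cabs normr1. Qed.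

Lemma cabs_sqr {R : realType} (z : R[i]) : (cabs z ^+ 2)%:C%C = z * z^*.
Proof. by rewrite rmorphXn /= -normcE normCK. Qed.

(** * The adjoint and the norm in a unital C*-algebra *)

Section CStarAlgebra.
Context {R : realType} {A : unitalCStarType R}.
Implicit Types (f g : {scalar A}) (a b x y z : A) (c : R[i]).

(* Restricting scalerAl and scalerAr to A keeps them from matching products of
   scalars, R[i] being an algebra over itself. *)
Let scaleMl c x y : (c *: x) * y = c *: (x * y).
Proof. by rewrite scalerAl. Qed.

Let scaleMr c x y : x * (c *: y) = c *: (x * y).
Proof. by rewrite scalerAr. Qed.

Lemma adjointZ_conj c x : adjoint (c *: x) = c^* *: adjoint x.
Proof. exact: adjointZ. Qed.

Lemma adjoint1 : adjoint (1 : A) = 1.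
Proof. by rewrite -[LHS]mul1r -[X in X * _]adjointK -adjointM mul1r adjointK. Qed.

Lemma cnorm1 : cnorm (1 : A) = 1.
Proof.
have n1 : cnorm (1 : A) != 0.
  by apply: contra_neq (oner_neq0 A); exact: cnorm0_eq0.
have := cnorm_cstar (1 : A); rewrite adjoint1 mulr1 expr2 => e.
by apply: (mulfI n1); rewrite -e mulr1.
Qed.

Lemma cnorm_ge0 x : 0 <= cnorm x.
Proof.
have n0 : cnorm (0 : A) = 0.
  by rewrite -(scale0r (1 : A)) cnormZ /cabs normr0 mul0r.
have nN : cnorm (- x) = cnorm x.
  by rewrite -scaleN1r cnormZ /cabs normrN1 mul1r.
by have := cnormD_le x (- x); rewrite subrr n0 nN -mulr2n pmulrn_lge0.
Qed.

(** * Positive functionals: polarization and the Cauchy-Schwarz inequality *)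

Lemma functionalD f x y : f (x + y) = f x + f y.
Proof. exact: linearD. Qed.

Lemma functionalZ f c x : f (c *: x) = c * f x.
Proof. exact: linearZ. Qed.

Lemma functional_exists (h : A -> R[i]) :
  (forall c x y, h (c *: x + y) = c * h x + h y) ->
  exists f : {scalar A}, forall x, f x = h x.
Proof.
move=> hl; pose m := GRing.isLinear.Build _ _ _ _ h hl.
by pose f : {scalar A} := HB.pack h m; exists f.
Qed.

Lemma functional_sqD f c x y :
  f (adjoint (x + c *: y) * (x + c *: y)) =
  f (adjoint x * x) + c * f (adjoint x * y) + c^* * f (adjoint y * x)
  + c * c^* * f (adjoint y * y).
Proof.
rewrite adjointD adjointZ_conj mulrDl !mulrDr !scaleMl !scaleMr scalerA.
rewrite !functionalD !functionalZ; ring.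
Qed.

(** Polarization: [f] is real on the squares of [x + y] and of [x + 'i *: y]. The first makes the
    sum of the two mixed terms real, the second makes their difference imaginary; adding the two
    identities gives the claim. *)
Lemma functional_hermitian f x y : positive_functional f ->
  f (adjoint x * y) = (f (adjoint y * x))^*.
Proof.
move=> fp.
have fr u : (f (adjoint u * u))^* = f (adjoint u * u) by exact: geC0_conj.
have := fr (x + 1 *: y); have := fr (x + 'i *: y); rewrite !functional_sqD.
rewrite !(rmorphD, rmorphM) /= !fr !conjCK conjCi rmorph1.
set p := f (adjoint x * y); set q := f (adjoint y * x).
set p' := p^*; set q' := q^* => ei e1.
have ei' : p - q = q' - p'.
  apply: (mulfI (neq0Ci R[i])).
  move: ei; set X := f _; set Y := f _ => ei.
  have -> : 'i * (p - q) =
    (X + 'i * p + - 'i * q + 'i * - 'i * Y) - (X + 'i * - 'i * Y) by ring.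
  by rewrite -ei; ring.
have e1' : p + q = q' + p'.
  move: e1; set X := f _; set Y := f _ => e1.
  have -> : p + q = (X + 1 * p + 1 * q + 1 * 1 * Y) - (X + Y) by ring.
  by rewrite -e1; ring.
apply: (mulfI (_ : 2%:R != 0 :> R[i])); first by rewrite pnatr_eq0.
have -> : 2%:R * p = (p + q) + (p - q) by ring.
by rewrite e1' ei'; ring.
Qed.

Lemma functional_adjoint f x : positive_functional f ->
  f (adjoint x) = (f x)^*.
Proof.
by move=> fp; have := functional_hermitian f x 1 fp; rewrite adjoint1 mulr1 mul1r.
Qed.

Lemma functional_CS f x y : positive_functional f -> 0 < f (adjoint x * x) ->
  f (adjoint x * y) * (f (adjoint x * y))^*
    <= f (adjoint x * x) * f (adjoint y * y).
Proof.
move=> fp X0; set p := f (adjoint x * y); set X := f (adjoint x * x) in X0 *.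
have Xr : X^* = X by exact/geC0_conj/ltW.
(* The element is [y] minus its projection on [x] for the form [f (adjoint x * y)]; its square has a
   nonnegative value, which is then multiplied by [X]. *)
have := fp (y + (- (p / X)) *: x); rewrite functional_sqD -/X -/p.
rewrite (functional_hermitian f y x) // -/p.
rewrite rmorphN fmorph_div /= Xr -(pmulr_rge0 _ X0) => h.
rewrite -subr_ge0; move: h.
set Y := f _; have nX : X != 0 by rewrite gt_eqF.
by apply: eq_ind; congr (0 <= _); field.
Qed.

(** * Construction of states *)

Lemma state_of f : bounded_functional f -> positive_functional f -> f 1 = 1 ->
  state f.
Proof.
move=> fb fp f1; split => //.
set E := [set cabs (f x) | x in [set x : A | cnorm x <= 1]].
have E1 : E 1 by exists 1; rewrite /= ?cnorm1 // f1 cabs1.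
have Eub : has_ubound E.
  have [M fM] := fb; exists `|M| => _ [x /= x1 <-].
  apply: le_trans (fM x) _.
  apply: (@le_trans _ _ (`|M| * cnorm x)).
    by rewrite ler_wpM2r ?cnorm_ge0 ?ler_norm.
  by rewrite ler_piMr.
apply/le_anti/andP; split; last exact: ub_le_sup.
(* Every element x of the unit ball satisfies |f x|^2 <= |f (x^* x)|, and x^* x
   is again in the unit ball. *)
have Esqr r : E r -> r ^+ 2 <= sup E.
  move=> [x /= x1 <-]; have xx1 : cnorm (adjoint x * x) <= 1.
    by rewrite cnorm_cstar expr_le1 ?cnorm_ge0.
  apply: (@le_trans _ _ (cabs (f (adjoint x * x)))); last first.
    by apply: ub_le_sup => //; exists (adjoint x * x).
  have := functional_CS f 1 x fp.
  rewrite adjoint1 !mul1r f1 mul1r => /(_ ltr01) h.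
  by rewrite -lecR cabs_sqr -normcE ger0_norm.
(* With [s = sup E > 1], some [r] in [E] exceeds [(s + 1) / 2]. Then [r ^+ 2 >= 2 * r - 1 > s],
   against [Esqr]. *)
rewrite leNgt; apply/negP => s1.
have e0 : 0 < (sup E - 1) / 2 by rewrite divr_gt0 ?subr_gt0.
have [|r Er rlt] := sup_adherent e0 (E := E); first by split => //; exists 1.
have := Esqr r Er; move: rlt; rewrite /functional_norm.
by move: (sup E) => s; have := sqr_ge0 (r - 1); rewrite !expr2; lra.
Qed.

Lemma state_ge0 f x : state f -> 0 <= f (adjoint x * x).
Proof. by case=> _ fp _ _; exact: fp. Qed.

Lemma state_adjoint f x : state f -> f (adjoint x) = (f x)^*.
Proof. by case=> _ fp _ _; exact: functional_adjoint. Qed.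

(** Positivity survives the compression by [x] because [adjoint x * (adjoint y * y) * x] is the
    square of [y * x]; division by [f (adjoint x * x)] restores the value 1 at the unit. *)
Lemma vector_state f x : state f -> 0 < f (adjoint x * x) ->
  exists2 g : {scalar A}, state g &
    forall y, g y = f (adjoint x * y * x) / f (adjoint x * x).
Proof.
move=> [[M fM] fp _ _] X0; set X := f _ in X0 *.
have [c u v|g gE] :=
  functional_exists (fun y => f (adjoint x * y * x) / X).
  by rewrite mulrDr mulrDl !scaleMr !scaleMl functionalD functionalZ; ring.
exists g => //; apply: state_of.
- exists (cabs X^-1 * (`|M| * (cnorm (adjoint x) * cnorm x))) => y.
  rewrite gE mulrC cabsM -[leRHS]mulrA ler_wpM2l ?cabs_ge0 //.
  apply: le_trans (fM _) _.
  apply: (@le_trans _ _ (`|M| * cnorm (adjoint x * y * x))).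
    by rewrite ler_wpM2r ?cnorm_ge0 ?ler_norm.
  rewrite -[leRHS]mulrA ler_wpM2l // mulrAC.
  apply: le_trans (cnormM_le _ _) _.
  by rewrite ler_wpM2r ?cnorm_ge0 ?cnormM_le.
- move=> y; rewrite gE divr_ge0 ?(ltW X0) //.
  by rewrite !mulrA -mulrA -adjointM; exact: fp.
- by rewrite gE mulr1 divff // gt_eqF.
Qed.

Lemma convex_state f g (t : R) : state f -> state g -> 0 <= t <= 1 ->
  exists2 h : {scalar A}, state h &
    forall x, h x = (1 - t)%:C%C * f x + t%:C%C * g x.
Proof.
move=> [[M fM] fp _ f1] [[N gN] gp _ g1] /andP[t0 t1].
have [c u v|h hE] :=
  functional_exists (fun x => (1 - t)%:C%C * f x + t%:C%C * g x).
  by rewrite !functionalD !functionalZ; ring.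
exists h => //; apply: state_of.
- exists ((1 - t) * M + t * N) => x; rewrite hE.
  rewrite -lecR -normcE; apply: le_trans (ler_normD _ _) _.
  rewrite !normcE -rmorphD lecR !cabsM mulrDl -!mulrA.
  have ct s : 0 <= s -> cabs (s%:C%C) = s.
    by move=> s0; apply: complexI; rewrite -normcE ger0_norm // lecR.
  by rewrite !ct ?subr_ge0 // lerD // ler_wpM2l ?subr_ge0.
- by move=> x; rewrite hE addr_ge0 // mulr_ge0 ?fp ?gp // lecR ?subr_ge0.
- by rewrite hE f1 g1 !mulr1 -rmorphD /= subrK.
Qed.

(** * Raising the second coordinate while the first stays fixed *)

(* In the GNS picture with cyclic vector xi and T = pi(a), g is the vector state
   of T^* xi + t xi, with t chosen to make its value at a vanish; the bound then
   comes from the components of T (T^* xi + t xi) along xi and T^* xi.  A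
   suitable t exists when |f (a^2)| < f (a a^* ), which fails only if f itself
   can serve as g. *)
Lemma state_raise_centered f a : state f -> f a = 0 ->
  exists2 g : {scalar A}, state g &
    g a = 0 /\ f (a * adjoint a) <= g (adjoint a * a).
Proof.
move=> fs fa; have [_ fp _ f1] := fs.
have fa' : f (adjoint a) = 0 by rewrite state_adjoint // fa rmorph0.
set S := f (a * adjoint a); set T := f (adjoint a * a).
have SE : f (adjoint (adjoint a) * adjoint a) = S by rewrite adjointK.
have S0 : 0 <= S by rewrite -SE; exact: fp.
have T0 : 0 <= T by exact: fp.
have [ST|TS] := real_leP (ger0_real S0) (ger0_real T0); first by exists f.
have {S0}Spos : 0 < S by exact: le_lt_trans TS.
have Sr : S^* = S by exact/geC0_conj/ltW.
pose P := f (a * a); pose Q := f (a * a * adjoint a).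
have PT : P * P^* <= S * T.
  by have := functional_CS f (adjoint a) a fp; rewrite SE adjointK; apply.
(* Here [T < S], so Cauchy-Schwarz gives [P * P^* <= S * T < S * S]. *)
have D0 : S * S - P * P^* != 0.
  by rewrite subr_eq0 gt_eqF // (le_lt_trans PT) // ltr_pM2l.
(* Cramer's rule for [teq] and its conjugate, a linear system in [t] and [t^*]. The left side of
   [teq] is [f (adjoint x * a * x)], the numerator of [g a]. *)
pose t := (P^* * Q - S * Q^*) / (S * S - P * P^*).
have tE : t^* = (P * Q^* - S * Q) / (S * S - P * P^*).
  by rewrite /t fmorph_div !(rmorphB, rmorphM) /= !conjCK Sr [P^* * P]mulrC.
have teq : t^* * S + t * P + Q = 0 by rewrite tE /t; field.
pose x := adjoint a + t *: 1.
have xE : adjoint x = a + t^* *: 1.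
  by rewrite adjointD adjointZ_conj adjointK adjoint1.
have X : f (adjoint x * x) = S + t * t^*.
  rewrite xE mulrDl !mulrDr !scaleMl !scaleMr !mulr1 !mul1r scalerA.
  rewrite !functionalD !functionalZ fa fa' f1; ring.
have X0 : 0 < f (adjoint x * x) by rewrite X ltr_wpDr // mul_conjC_ge0.
have [g gs gE] := vector_state f x fs X0.
exists g => //; split.
  rewrite gE xE mulrDl mulrDr !scaleMl !mul1r mulrDl !scaleMr !mulr1.
  rewrite !scaleMl !functionalD !functionalZ functionalD functionalZ fa.
  rewrite -/P -/Q -/S.
  have -> : Q + t^* * S + t * (P + t^* * 0) = t^* * S + t * P + Q by ring.
  by rewrite teq mul0r.
(* For the form given by [f], [z] is the projection of [a * x] on the span of the orthogonal
   elements [1] and [adjoint a]: the pairings of [a * x] with them are [S] and, by [teq],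
   [- t^* * S]. Hence [N] and [Z] agree, and Cauchy-Schwarz bounds [f] at the square of [a * x]
   below by [S * f (adjoint x * x)]. *)
pose z := S *: 1 - t^* *: adjoint a.
have zE : adjoint z = S *: 1 - t *: a.
  rewrite /z -scaleNr adjointD !adjointZ_conj adjoint1 adjointK Sr.
  by rewrite rmorphN /= conjCK scaleNr.
have Z : f (adjoint z * z) = S * (S + t * t^*).
  rewrite zE /z mulrBl !mulrBr !scaleMl !scaleMr !mulr1 !mul1r.
  rewrite !linearB !functionalZ /= fa fa' f1 -/S; ring.
have N : f (adjoint z * (a * x)) = S * (S + t * t^*).
  rewrite zE /x mulrBl mulrDr !scaleMl !scaleMr !mulr1 !mul1r.
  rewrite linearB !functionalZ /= mulrDr !scaleMr mulrA.
  rewrite !functionalD !functionalZ fa -/S -/P -/Q.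
  have -> : Q = - (t^* * S + t * P) by apply/eqP; rewrite -addr_eq0 addrC teq.
  ring.
have Z0 : 0 < f (adjoint z * z) by rewrite Z mulr_gt0 // -X.
have := functional_CS f z (a * x) fp Z0; rewrite N -Z geC0_conj ?(ltW Z0) //.
rewrite ler_pM2l // Z -X adjointM => h.
by rewrite gE ler_pdivlMr // !mulrA in h *.
Qed.

(** Reduction to the centered case by the shift [a - m *: 1]: since [f] and [g] share the value [m]
    at [a], both sides of the inequality drop by the same [m * m^*]. *)
Lemma state_raise f a : state f ->
  exists2 g : {scalar A}, state g &
    g a = f a /\ f (a * adjoint a) <= g (adjoint a * a).
Proof.
move=> fs; have [_ _ _ f1] := fs; pose m := f a.
have fb : f (a - m *: 1) = 0 by rewrite linearB functionalZ /= f1 mulr1 subrr.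
have [g gs [gb le]] := state_raise_centered f (a - m *: 1) fs fb.
have [_ _ _ g1] := gs.
have ga : g a = m.
  by move/eqP: gb; rewrite linearB functionalZ /= g1 mulr1 subr_eq0 => /eqP.
exists g => //; split => //; move: le.
have bE : adjoint (a - m *: 1) = adjoint a - m^* *: 1.
  by rewrite -!scaleNr adjointD adjointZ_conj adjoint1 rmorphN.
rewrite bE !mulrBl !mulrBr !scaleMl !scaleMr !mulr1 !mul1r !linearB.
rewrite !functionalZ /= !state_adjoint // f1 g1 ga -/m.
by rewrite !mulr1 !subrr !addr0 [m^* * m]mulrC lerD2r.
Qed.

Lemma state_match f phi a : state f -> state phi -> f a = phi a ->
  phi (adjoint a * a) <= f (a * adjoint a) ->
  exists2 g : {scalar A}, state g &
    g a = f a /\ g (adjoint a * a) = f (a * adjoint a).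
Proof.
move=> fs phis fphi lo; have [chi chis [fchi hi]] := state_raise f a fs.
have realE (z : R[i]) : 0 <= z -> z = (complex.Re z)%:C%C.
  by move=> z0; rewrite RRe_real // ger0_real.
have uE := realE _ (state_ge0 phi a phis).
have wE := realE _ (state_ge0 chi a chis).
have := realE _ (state_ge0 f (adjoint a) fs); rewrite adjointK => vE.
move: lo hi uE wE vE; set u' := phi _; set w' := chi _; set v' := f (_ * _).
move: (complex.Re u') (complex.Re w') (complex.Re v') => u w v lo hi uE wE vE.
move: lo hi; rewrite uE wE vE !lecR => lo hi.
(* If [u = w], then [v], squeezed between them, equals [u] and [phi] already works; otherwise the
   weight [(v - u) / (w - u)] solves [(1 - t) * u + t * w = v]. *)
have [uw|uw] := eqVneq u w.
  exists phi => //; split; first by [].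
  by rewrite -/u' uE; congr (_%:C%C); lra.
have uw0 : 0 < w - u by rewrite subr_gt0 lt_neqAle uw; lra.
have [|h hs hE] := convex_state phi chi ((v - u) / (w - u)) phis chis.
  by rewrite divr_ge0 ?(ltW uw0) ?subr_ge0 //= ler_pdivrMr // mul1r; lra.
exists h => //; split.
  by rewrite hE fchi -fphi -mulrDl -rmorphD /= subrK mul1r.
rewrite hE -/u' -/w' uE wE -!rmorphM -rmorphD; congr (_%:C%C).
by field; rewrite gt_eqF.
Qed.

End CStarAlgebra.

Theorem theorem2p16 (R : realType) (A : unitalCStarType R) (a : A) :
  (DW (adjoint a) `<=` conj_fst (DW a)
   <->
   forall mu : R[i], numerical_range a mu ->
     DW_section (adjoint a) (conjc mu) `<=` DW_section a mu)
  /\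
  (DW (adjoint a) = conj_fst (DW a)
   <->
   forall f : {scalar A}, state f ->
     exists phi psi : {scalar A},
       [/\ state phi, state psi,
           f a = phi a /\ phi (adjoint a * a) <= f (a * adjoint a) &
           f a = psi a /\ psi (a * adjoint a) <= f (adjoint a * a)]).
Proof.
(* [DW] records only real parts; states are real on squares, so equal real parts give equal values
   in [R[i]]. *)
have Re_eq f g (x y : A) : state f -> state g ->
    complex.Re (f (adjoint x * x)) = complex.Re (g (adjoint y * y)) ->
    f (adjoint x * x) = g (adjoint y * y).
  move=> fs gs; rewrite -(RRe_real (ger0_real (state_ge0 f x fs))).
  by rewrite -(RRe_real (ger0_real (state_ge0 g y gs))) /= => ->.
split; split.
- move=> sub mu _ r /sub [[nu s] [f fs [<- <-]]] /= [nuE <-].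
  by exists f => //; rewrite -[mu]conjcK -nuE conjcK.
- move=> sub [nu r] [f fs [<- <-]]; rewrite state_adjoint //.
  (* The hypothesis is used at [mu = f a], which lies in the numerical range through [f] itself. *)
  exists (f a, complex.Re (f (adjoint (adjoint a) * adjoint a))) => //.
  by apply: sub; exists f => //; rewrite state_adjoint.
- move=> eqDW f fs.
  have : DW (adjoint a)
      (f (adjoint a), complex.Re (f (adjoint (adjoint a) * adjoint a))).
    by exists f.
  rewrite eqDW => -[_ [phi phis <-] /= [phia phiE]].
  have : conj_fst (DW a) ((f a)^*%C, complex.Re (f (adjoint a * a))).
    by exists (f a, complex.Re (f (adjoint a * a))) => //; exists f.
  rewrite -eqDW => -[psi psis [psia psiE]].
  exists phi, psi; split=> //.
    split; first by apply: (can_inj (@conjcK R)); rewrite phia state_adjoint.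
    by rewrite (Re_eq _ _ _ _ phis fs phiE) adjointK.
  split; last by rewrite -(Re_eq _ _ _ _ psis fs psiE) adjointK.
  by apply: (can_inj (@conjcK R)); rewrite -psia state_adjoint.
- move=> H; apply/seteqP; split=> [_ [f fs <-]|_ [_ [f fs <-] <-]] /=.
    have [phi [_ [phis _ [fphi le] _]]] := H f fs.
    have [g gs [ga gE]] := state_match f phi a fs phis fphi le.
    exists (g a, complex.Re (g (adjoint a * a))); first by exists g.
    by rewrite /= ga gE adjointK state_adjoint.
  have [_ [psi [_ psis _ [fpsi le]]]] := H f fs.
  (* Applied to [adjoint a], the matching exchanges the two products, so [g] realizes the conjugated
     point of [f] in [DW (adjoint a)]. *)
  have [||g gs [ga gE]] := state_match f psi (adjoint a) fs psis.
  + by rewrite !state_adjoint // fpsi.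
  + by rewrite adjointK.
  exists g => //; rewrite ga gE adjointK.
  by rewrite state_adjoint.
Qed.
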